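(* Fix $d,k\in\mathbb N$ and let $A\in\mathbb R^{d^k\times d^k}$. Let $x=x_1\otimes\cdots\otimes x_k$, where $x_1,\dots,x_k\in\mathbb R^d$ are independent and each $x_i$ is either a Rademacher vector or a standard Gaussian vector $\mathcal N(0,I_d)$. Let $\bar A:=\frac{1}{2^k}\sum_{\mathcal V\subseteq[k]}A^{\Gamma_{\mathcal V}}$ be the average of all partial transposes of $A$. Then $$\operatorname{Var}[x^\top A x]\le\sum_{\mathcal S\subsetneq[k]}2^{k-|\mathcal S|}\,\big\|\operatorname{tr}_{\mathcal S}(\bar A)\big\|_F^2 .$$ Furthermore, if all $x_i$ are $\mathcal N(0,I_d)$, this inequality is an equality.
   Context: $\otimes$ is the standard Kronecker product; $[k]=\{1,\dots,k\}$. A Rademacher vector has iid entries uniform on $\{\pm1\}$. Identify $\mathbb R^{d^k\times d^k}$ with $(\mathbb R^{d\times d})^{\otimes k}$ (''$k$ subsystems of dimension $d$''). Partial trace: for $\mathcal S\subseteq[k]$, $\operatorname{tr}_{\mathcal S}:\mathbb R^{d^k\times d^k}\to\mathbb R^{d^{k-|\mathcal S|}\times d^{k-|\mathcal S|}}$ is the unique linear map with $\operatorname{tr}_{\mathcal S}(M_1\otimes\cdots\otimes M_k)=\big(\prod_{j\in\mathcal S}\operatorname{tr}(M_j)\big)\bigotimes_{j\notin\mathcal S}M_j$ for all $M_j\in\mathbb R^{d\times d}$ (for $\mathcal S=\emptyset$ it is the identity). Equivalently, for a single index, $\operatorname{tr}_{\{i\}}(A)=\sum_{j=1}^d(I^{\otimes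 i-1}\otimes e_j\otimes I^{\otimes k-i})^\top A(I^{\otimes i-1}\otimes e_j\otimes I^{\otimes k-i})$, with $I=I_d$ and $e_j\in\mathbb R^d$ standard basis vectors. Partial transpose: for $\mathcal V\subseteq[k]$, $A\mapsto A^{\Gamma_{\mathcal V}}$ is the unique linear map with $(M_1\otimes\cdots\otimes M_k)^{\Gamma_{\mathcal V}}=N_1\otimes\cdots\otimes N_k$ where $N_j=M_j^\top$ if $j\in\mathcal V$ and $N_j=M_j$ otherwise. The sum over $\mathcal S\subsetneq[k]$ ranges over all proper subsets of $[k]$ (including $\emptyset$). *)

(* Defs.v *)
From HB Require Import structures.
From mathcomp Require Import all_boot all_order all_algebra.
From mathcomp Require Import all_classical all_reals all_analysis.
Set Implicit Arguments. Unset Strict Implicit. Unset Printing Implicit Defensive.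
Import Order.TTheory GRing.Theory Num.Theory.
Local Open Scope classical_set_scope.
Local Open Scope ring_scope.

Definition midx (d : nat) (I : finType) := {ffun I -> 'I_d}.

(* a real array with rows/columns indexed by multi-indices over sites I,
   i.e. an element of (R^{d x d})^{tensor |I|} *)
Definition tmat (R : Type) (d : nat) (I : finType) := midx d I -> midx d I -> R.

Section Tensor.
Variables (R : realType) (d k : nat).

Definition tensor_vec (x : 'I_k -> 'I_d -> R) : midx d 'I_k -> R :=
  fun a => \prod_(j < k) x j (a j).

Definition quad_form (A : tmat R d 'I_k) (v : midx d 'I_k -> R) : R :=
  \sum_(a : midx d 'I_k) \sum_(b : midx d 'I_k) v a * A a b * v b.

Definition ptranspose (V : {set 'I_k}) (A : tmat R d 'I_k) : tmat R d 'I_k :=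
  fun a b => A [ffun j => if j \in V then b j else a j]
               [ffun j => if j \in V then a j else b j].

Definition avg_ptranspose (A : tmat R d 'I_k) : tmat R d 'I_k :=
  fun a b => (2 ^+ k)^-1 * \sum_(V : {set 'I_k}) ptranspose V A a b.

(* gluing a multi-index on the kept sites with one on the traced sites *)
Definition glue (S : {set 'I_k}) (a : midx d {j : 'I_k | j \notin S})
  (l : midx d {j : 'I_k | j \in S}) : midx d 'I_k :=
  [ffun j => (if j \in S as b return (j \in S) = b -> 'I_d
              then fun h => l (exist _ j h)
              else fun h => a (exist _ j (negbT h))) erefl].

Definition ptrace (S : {set 'I_k}) (A : tmat R d 'I_k) :
    tmat R d {j : 'I_k | j \notin S} :=
  fun a b => \sum_(l : midx d {j : 'I_k | j \in S}) A (glue a l) (glue b l).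

End Tensor.

Arguments ptranspose {R d k} V A _ _.
Arguments ptrace {R d k} S A _ _.
Arguments glue {d k} S a l.
Arguments avg_ptranspose {R d k} A _ _.
Arguments quad_form {R d k} A v.
Arguments tensor_vec {R d k} x _.


Definition frob2 (R : realType) (d : nat) (I : finType) (M : tmat R d I) : R :=
  \sum_(a : midx d I) \sum_(b : midx d I) M a b ^+ 2.

Section Prob.
Local Open Scope ereal_scope.
Context {dT : measure_display} {T : measurableType dT} {R : realType}.

Definition mutually_independent (P : probability T R) (I : finType)
    (X : I -> T -> R) : Prop :=
  forall (J : {set I}) (B : I -> set R), (forall i, measurable (B i)) ->
    P (\big[setI/setT]_(i in J) (X i @^-1` B i))
    = \prod_(i in J) P (X i @^-1` B i).

Definition rademacher_rv (P : probability T R) (X : T -> R) : Prop :=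
  P (X @^-1` [set 1%R]) = (2^-1)%:E /\ P (X @^-1` [set (-1)%R]) = (2^-1)%:E.

Definition std_gaussian_rv (P : probability T R) (X : T -> R) : Prop :=
  forall B : set R, measurable B -> P (X @^-1` B) = normal_prob 0%R 1%R B.
End Prob.

(* Main.v *)
(** Passing from A to the average B of its partial transposes does not change
    the quadratic form, and B is invariant under every partial transpose.
    Expanding the square and using independence,
      E[Y^2] = \sum_(z, z') B z * B z' * \prod_j K_j (z j) (z' j)
    over pairs z = (a, b) of multi-indices, where K_j is the kernel of fourth
    moments of the entries of x_j.  In the Gaussian case K_j is the sum over the
    three pairings of {p, q, r, s}; expanding the product over j according to the
    set S of sites carrying the pairing (p q)(r s) gives the partial trace over S,
    while the two other pairings contribute equally because B is invariant.
    S = [k] yields E[Y]^2.  The Rademacher kernel has the same rank one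
    decomposition as the Gaussian one with some weights replaced by 0, so that
    its tensor products are dominated, as quadratic forms, by the Gaussian ones. *)

Require Import Defs.
From HB Require Import structures.
From mathcomp Require Import all_boot all_order all_algebra.
From mathcomp Require Import all_classical all_reals all_analysis.
From mathcomp Require Import measurable_realfun ring lra.
Import Order.TTheory GRing.Theory Num.Theory.
Import numFieldNormedType.Exports.
Import HBNNSimple.
Local Open Scope classical_set_scope.
Local Open Scope ring_scope.

(** * Integration against image measures *)

Section transfer.
Local Open Scope ereal_scope.
Context {d d' : measure_display} {T : measurableType d} {U : measurableType d'}
  {R : realType} (mu : {measure set T -> \bar R}) (nu : {measure set U -> \bar R}).
Variables (X : T -> U) (W : T -> R) (c : R).
Hypotheses (mX : measurable_fun setT X) (mW : measurable_fun setT W)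
  (W0 : forall t, (0 <= W t)%R) (c0 : (0 <= c)%R).
Hypothesis XW : forall B, measurable B ->
  \int[mu]_(t in X @^-1` B) (W t)%:E = c%:E * nu B.

Let transfer_nnsfun (h : {nnsfun U >-> R}) :
  \int[mu]_t (h (X t) * W t)%:E = c%:E * \int[nu]_u (h u)%:E.
Proof.
have mh y : measurable (h @^-1` [set y]) by exact: measurable_funPTI.
have mXh y : measurable (X @^-1` (h @^-1` [set y])).
  by rewrite -[X in measurable X]setTI; exact: mX.
have hge0 y u : (0 <= y * \1_(h @^-1` [set y]) u)%R.
  rewrite indicE; have [/set_mem/= <-|_] := boolP (u \in _); last by rewrite mulr0.
  by rewrite mulr1.
have [n [s hE]] : exists n (s : nat -> R),
    forall u, h u = (\sum_(i < n) (s i * \1_(h @^-1` [set s i]) u))%R.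
  by eexists; eexists; exact: fimfunEord.
transitivity (\sum_(i < n) \int[mu]_t
    (s i * \1_(h @^-1` [set s i]) (X t) * W t)%:E).
  rewrite -ge0_integral_sum//=.
  - by apply: eq_integral => t _; rewrite hE mulr_suml sumEFin.
  - move=> i; apply/measurable_EFinP; apply: measurable_funM => //.
    apply: measurable_funM => //; apply: measurableT_comp => //.
  - by move=> i t _; rewrite lee_fin mulr_ge0.
transitivity (c%:E * \sum_(i < n) \int[nu]_u
    (s i * \1_(h @^-1` [set s i]) u)%:E);
  last first.
  congr *%E; rewrite -ge0_integral_sum//=.
  - by apply: eq_integral => t _; rewrite hE sumEFin.
  - move=> i; apply/measurable_EFinP; exact: measurable_funM.
  - by move=> i t _; rewrite lee_fin.
rewrite ge0_sume_distrr; last first.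
  by move=> i _; apply: integral_ge0 => u _; rewrite lee_fin.
apply: eq_bigr => i _; set y := s i.
(* A negative level has an empty preimage because [h] is nonnegative, so both sides vanish; a
   nonnegative level can be pulled out of both integrals, which leaves [XW] for the level set. *)
have [y0|y0] := ltP y 0%R.
  have z u : \1_(h @^-1` [set y]) u = 0%R :> R.
    rewrite indicE; apply/eqP; rewrite pnatr_eq0 eqb0; apply/negP.
    by move=> /set_mem/= hu; have : (0 <= h u)%R by []; rewrite hu leNgt y0.
  rewrite integral0_eq; last by move=> t _; rewrite z mulr0 mul0r.
  by rewrite integral0_eq ?mule0// => u _; rewrite z mulr0.
under eq_integral do rewrite -mulrA EFinM.
rewrite ge0_integralZl//; last 2 first.
- apply/measurable_EFinP; apply: measurable_funM => //.
  exact: measurableT_comp.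
- by move=> t _; rewrite lee_fin mulr_ge0.
under [in RHS]eq_integral do rewrite EFinM.
rewrite ge0_integralZl//; last exact/measurable_EFinP.
rewrite integral_indic// setIT muleCA -XW//; congr *%E.
rewrite [RHS]integral_mkcond; apply: eq_integral => t _.
rewrite patchE indicE; have -> : (t \in X @^-1` (h @^-1` [set y])) =
    (X t \in h @^-1` [set y]) by apply/idP/idP => /set_mem ?; apply/mem_set.
by case: ifPn => _; rewrite ?mul1r ?mul0r.
Qed.

(* Two measures that agree on sets integrate alike; here the first one, the
   image under X of the measure of density W, need not be constructed. *)
Lemma ge0_integral_image_density (g : U -> R) : measurable_fun setT g ->
  (forall u, 0 <= g u)%R ->
  \int[mu]_t (g (X t) * W t)%:E = c%:E * \int[nu]_u (g u)%:E.
Proof.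
move=> mg g0; have mEg : measurable_fun setT (EFin \o g) by exact/measurable_EFinP.
(* Both sides are limits along simple functions increasing to [g], by monotone convergence; the two
   sequences coincide by the case of simple functions. *)
pose h := nnsfun_approx measurableT mEg.
have hg u : (h n u)%:E @[n --> \oo] --> (g u)%:E.
  by apply: (@cvg_nnsfun_approx _ _ _ _ measurableT _ mEg) => // v _; rewrite lee_fin.
have ndh : nondecreasing_seq (h : (U -> R)^nat) by exact: nd_nnsfun_approx.
have L : \int[mu]_t (h n (X t) * W t)%:E @[n --> \oo] --> \int[mu]_t (g (X t) * W t)%:E.
  rewrite [X in _ --> X](_ : _ =
    \int[mu]_t limn (fun n => (h n (X t) * W t)%:E)); last first.
    apply: eq_integral => t _; apply/esym/cvg_lim => //.
    by under eq_fun do rewrite EFinM; rewrite EFinM; exact: cvgeZr.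
  apply: cvg_monotone_convergence => //.
  - move=> n; apply/measurable_EFinP; apply: measurable_funM => //.
    exact: measurableT_comp.
  - by move=> n t _; rewrite lee_fin mulr_ge0.
  - move=> t _ m n mn; rewrite lee_fin ler_wpM2r//.
    by have /asboolP/(_ (X t)) := ndh _ _ mn.
have L' : c%:E * \int[nu]_u (h n u)%:E @[n --> \oo] --> c%:E * \int[nu]_u (g u)%:E.
  apply: cvgeZl => //.
  rewrite [X in _ --> X](_ : _ = \int[nu]_u limn (fun n => (h n u)%:E)); last first.
    by apply: eq_integral => u _; apply/esym/cvg_lim => //; exact: hg.
  apply: cvg_monotone_convergence => //.
  - by move=> n; apply/measurable_EFinP.
  - by move=> n t _; rewrite lee_fin.
  - by move=> u _ m n mn; rewrite lee_fin; have /asboolP/(_ u) := ndh _ _ mn.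
have Lh : (fun n => \int[mu]_t (h n (X t) * W t)%:E) =
    (fun n => c%:E * \int[nu]_u (h n u)%:E) by apply/funext => n.
by rewrite Lh in L; exact: cvg_unique L L'.
Qed.

End transfer.

(** * Expectation of a product of independent variables *)

Section independence.
Local Open Scope ereal_scope.
Context {dT : measure_display} {T : measurableType dT} {R : realType}
  {P : probability T R} {I : finType} (X : I -> {RV P >-> R}).
Hypothesis Xind : mutually_independent P (fun i => X i : T -> R).

Lemma indep_integral_indic (B : I -> set R) : (forall i, measurable (B i)) ->
  \int[P]_t (\prod_i \1_(B i) (X i t))%:E = \prod_i P (X i @^-1` B i).
Proof.
move=> mB; have := Xind [set: I]%SET B mB.
rewrite (eq_bigl xpredT)/=; last by move=> i; rewrite finset.in_setT.
rewrite [in RHS](eq_bigl xpredT)/=; last by move=> i; rewrite finset.in_setT.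
move=> <-; rewrite -[X in P X]setIT -integral_indic//; last first.
  by apply: bigsetI_measurable => i _; exact: measurable_funPTI.
apply: eq_integral => t _; congr EFin.
elim/big_rec2: _ => [|i A r _ ->]; first by rewrite indicT.
by rewrite indicI/=; congr (_ * _)%R.
Qed.

(** Induction on the list [s] of the indices whose factor may differ from an indicator. With no such
    index the claim is independence itself; each further step frees one factor, the others being
    collected in a density [W]. *)
Let indep_ge0_integral_prod_seq (s : seq I) (f : I -> R -> R) (m : I -> R) :
  (forall i, i \notin s -> exists2 B, measurable B & f i = \1_B) ->
  (forall i, measurable_fun setT (f i)) -> (forall i x, (0 <= f i x)%R) ->
  (forall i, \int[P]_t (f i (X i t))%:E = (m i)%:E) ->
  \int[P]_t (\prod_i f i (X i t))%:E = (\prod_i m i)%:E.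
Proof.
elim: s f m => [|i s IH] f m fs mf f0 fm.
  have /choice[B fB] : forall i, exists B, measurable B /\ f i = \1_B.
    by move=> i; have [B] := fs i isT; exists B.
  under eq_integral do under eq_bigr do rewrite (fB _).2.
  rewrite indep_integral_indic => [|i]; last exact: (fB i).1.
  rewrite -prodEFin; apply: eq_bigr => i _.
  rewrite -fm (fB i).2 -[X in P X]setIT -integral_indic//.
  exact: measurable_funPTI (fB i).1.
pose W t := (\prod_(j | j != i) f j (X j t))%R.
pose c := (\prod_(j | j != i) m j)%R.
have m0 j : (0 <= m j)%R.
  by rewrite -lee_fin -fm; apply: integral_ge0 => t _; rewrite lee_fin.
have mfX j : measurable_fun setT (f j \o X j) by exact: measurableT_comp.
have mW : measurable_fun setT W.
  rewrite (_ : W = fun t => \prod_(j <- [seq j <- index_enum I | j != i])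
    (f j \o X j) t)%R; last by apply/funext => t; rewrite big_filter.
  by apply: measurable_prod => j _; exact: mfX.
have W0 t : (0 <= W t)%R by apply: prodr_ge0 => j _; exact: f0.
have c0 : (0 <= c)%R by apply: prodr_ge0.
(* Replacing the factor at [i] by the indicator of [B] brings the induction hypothesis into play:
   the image under [X i] of the measure with density [W] is [c] times the law of [X i]. *)
have XW B : measurable B ->
    \int[P]_(t in X i @^-1` B) (W t)%:E = c%:E * distribution P (X i) B.
  move=> mB.
  pose f' j := if j == i then \1_B else f j.
  pose m' j := if j == i then fine (P (X i @^-1` B)) else m j.
  have mXB : measurable (X i @^-1` B) by exact: measurable_funPTI.
  have PB : P (X i @^-1` B) = (fine (P (X i @^-1` B)))%:E by rewrite fineK// fin_num_measure.
  transitivity (\int[P]_t (\prod_j f' j (X j t))%:E).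
    rewrite integral_mkcond; apply: eq_integral => t _.
    rewrite (bigD1 i)//= /f' eqxx patchE indicE.
    have -> : (t \in X i @^-1` B) = (X i t \in B).
      by apply/idP/idP => /set_mem ?; apply/mem_set.
    under eq_bigr => j /negPf -> do [].
    by case: ifPn => _; rewrite ?mul1r ?mul0r.
  rewrite (IH f' m').
  - rewrite (bigD1 i)//= /m' eqxx EFinM -PB muleC; congr (_%:E * _).
    by apply: eq_bigr => j /negPf ->.
  - move=> j js; rewrite /f'; case: eqP => [_|/eqP ji]; first by exists B.
    by apply: fs; rewrite inE negb_or ji.
  - by move=> j; rewrite /f'; case: eqP.
  - by move=> j x; rewrite /f'; case: eqP => // _; rewrite indicE.
  - move=> j; rewrite /f' /m'; case: eqP => // ->.
    by rewrite -PB -[in RHS](setIT (X i @^-1` B)) -integral_indic.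
transitivity (\int[P]_t (f i (X i t) * W t)%:E).
  by apply: eq_integral => t _; rewrite (bigD1 i).
rewrite (ge0_integral_image_density P (distribution P (X i)) (X i) W c)//.
rewrite ge0_integral_distribution//=; last 2 first.
- exact/measurable_EFinP.
- by move=> y; rewrite lee_fin.
by rewrite fm -EFinM mulrC [in RHS](bigD1 i).
Qed.

Lemma indep_ge0_integral_prod (f : I -> R -> R) (m : I -> R) :
  (forall i, measurable_fun setT (f i)) -> (forall i x, (0 <= f i x)%R) ->
  (forall i, \int[P]_t (f i (X i t))%:E = (m i)%:E) ->
  \int[P]_t (\prod_i f i (X i t))%:E = (\prod_i m i)%:E.
Proof.
by apply: (indep_ge0_integral_prod_seq (enum I)) => i; rewrite mem_enum.
Qed.

(* Splitting every factor into its positive and negative parts and expanding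
   the product reduces the claim to nonnegative factors. *)
Lemma indep_integral_prod (f : I -> R -> R) (m : I -> R) :
  (forall i, measurable_fun setT (f i)) ->
  (forall i, P.-integrable setT (fun t => (f i (X i t))%:E)) ->
  (forall i, \int[P]_t (f i (X i t))%:E = (m i)%:E) ->
  P.-integrable setT (fun t => (\prod_i f i (X i t))%:E) /\
  \int[P]_t (\prod_i f i (X i t))%:E = (\prod_i m i)%:E.
Proof.
move=> mf intf fm.
pose h (b : bool) i x := (if b then Num.max (f i x) 0 else Num.max (- f i x) 0)%R.
pose q (b : bool) i := fine (\int[P]_t (h b i (X i t))%:E).
have mh b i : measurable_fun setT (h b i).
  by rewrite /h; case: b; apply: measurable_maxr => //; exact: measurableT_comp.
have h0 b i x : (0 <= h b i x)%R by rewrite /h; case: b; rewrite le_max lexx orbT.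
have hX b i : P.-integrable setT (fun t => (h b i (X i t))%:E).
  apply: le_integrable (intf i) => //.
    by apply/measurable_EFinP; apply: measurableT_comp.
  move=> t _; rewrite /= lee_fin ger0_norm// /h; case: b.
    by rewrite ge_max ler_norm normr_ge0.
  by rewrite ge_max -normrN ler_norm normr_ge0.
have qE b i : \int[P]_t (h b i (X i t))%:E = (q b i)%:E.
  by rewrite /q fineK//; exact: integrable_fin_num.
have fh i x : f i x = (h true i x - h false i x)%R.
  rewrite /h; have [fx|fx] := leP 0%R (f i x).
    by rewrite max_r ?oppr_le0// subr0.
  by rewrite max_l ?oppr_ge0 ?ltW// sub0r opprK.
have mq i : m i = (q true i - q false i)%R.
  apply: EFin_inj; rewrite EFinB -!qE -fm -integralB_EFin//; try exact: hX.
  by apply: eq_integral => t _; rewrite fh EFinB.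
have prodh (J : {set I}) : \int[P]_t (\prod_i h (i \in J) i (X i t))%:E =
    (\prod_i q (i \in J) i)%:E.
  by apply: (indep_ge0_integral_prod (fun i => h (i \in J) i)) => // i.
have iprodh (J : {set I}) :
    P.-integrable setT (fun t => (\prod_i h (i \in J) i (X i t))%:E).
  apply/integrableP; split.
    apply/measurable_EFinP; apply: measurable_prod => k _.
    exact: measurableT_comp.
  under eq_integral do rewrite gee0_abs ?lee_fin ?prodr_ge0//.
  by rewrite prodh ltry.
(* [J] records the factors from which the positive part is taken; every other factor contributes a
   sign. *)
have prodB (u v : I -> R) : (\prod_i (u i - v i) =
    \sum_(J : {set I}) (\prod_i (if i \in J then 1 else -1)) *
      \prod_i (if i \in J then u i else v i))%R.
  rewrite bigA_distr; apply: eq_bigr => J _; rewrite -big_split/=.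
  by apply: eq_bigr => k _; case: ifP; rewrite ?mul1r ?mulN1r.
have fE t : (\prod_i f i (X i t))%:E = \sum_(J : {set I})
    (\prod_(i : I) (if i \in J then 1 else -1))%:E * (\prod_i h (i \in J) i (X i t))%:E.
  under eq_bigr do rewrite fh.
  rewrite prodB -sumEFin; apply: eq_bigr => J _; rewrite EFinM; congr (_ * _%:E).
have intS (J : {set I}) : P.-integrable setT (fun t =>
    (\prod_(i : I) (if i \in J then 1 else -1))%:E * (\prod_i h (i \in J) i (X i t))%:E).
  exact: integrableZl.
split.
  under eq_fun do rewrite fE.
  exact: integrable_sum.
under eq_integral do rewrite fE.
rewrite integral_sum//.
transitivity (\sum_(J : {set I}) (\prod_(i : I) (if i \in J then 1 else -1) *
    \prod_i q (i \in J) i)%:E).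
  by apply: eq_bigr => J _; rewrite integralZl// prodh -EFinM.
rewrite sumEFin; congr EFin; under [RHS]eq_bigr do rewrite mq.
rewrite prodB; apply: eq_bigr => J _; congr (_ * _)%R.
by apply: eq_bigr => i _; case: ifP.
Qed.

End independence.

(** * Moments of the standard normal law *)

Section gaussian_moments.
Local Open Scope ring_scope.
Context {R : realType}.
Notation mu := (@lebesgue_measure R).

(* The integrand F' = p - q is nonnegative on [0, s] and nonpositive beyond s,
   so that only the fundamental theorem for integrands of constant sign is used. *)
Lemma ge0_integral_derive_eq (p q F : R -> R) (s : R) : 0 < s ->
  continuous p -> continuous q -> (forall x, 0 <= p x) -> (forall x, 0 <= q x) ->
  (forall x : R, is_derive x 1 F (p x - q x)) ->
  (forall x, 0 <= x <= s -> q x <= p x) -> (forall x, s <= x -> p x <= q x) ->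
  F 0 = 0 -> F x @[x --> +oo] --> (0 : R) ->
  (\int[mu]_(x in `[0%R, +oo[) (p x)%:E = \int[mu]_(x in `[0%R, +oo[) (q x)%:E)%E.
Proof.
move=> s0 cp cq p0 q0 dF qp pq F0 Fy.
have mp : measurable_fun setT p by exact: continuous_measurable_fun.
have mq : measurable_fun setT q by exact: continuous_measurable_fun.
have cpq : continuous (fun x => p x - q x) by move=> x; apply: cvgB; [exact: cp|exact: cq].
have cqp : continuous (fun x => q x - p x) by move=> x; apply: cvgB; [exact: cq|exact: cp].
have cF : continuous F.
  by move=> x; apply: differentiable_continuous; apply/derivable1_diffP; exact: ex_derive.
(* The excess of [p] over [q] on [0, s] and the excess of [q] over [p] beyond [s] are both [F s],
   since [F] vanishes at 0 and at infinity; they compensate each other. *)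
have I1 : (\int[mu]_(x in `[0%R, s]) (p x - q x)%:E = (F s)%:E)%E.
  rewrite (@continuous_FTC2 _ _ F)//.
  - by rewrite F0 sube0.
  - exact: continuous_subspaceT.
  - split; [by move=> x _; exact: ex_derive| |].
      by apply: cvg_at_right_filter; exact: cF.
    by apply: cvg_at_left_filter; exact: cF.
  - by move=> x _; rewrite derive1E; exact: derive_val.
have I2 : (\int[mu]_(x in `[s, +oo[) (q x - p x)%:E = (F s)%:E)%E.
  rewrite (@ge0_continuous_FTC2y _ _ (fun x => - F x) _ 0).
  - by rewrite -EFinB sub0r opprK.
  - by move=> x sx; rewrite subr_ge0 pq.
  - exact: continuous_subspaceT.
  - by rewrite -oppr0; exact: cvgN.
  - by move=> x _; exact: ex_derive.
  - by apply: cvg_at_right_filter; apply: cvgN; exact: cF.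
  - by move=> x _; rewrite derive1E derive_val opprB.
have split_at_s (f : R -> R) : measurable_fun setT f -> (forall x, 0 <= f x) ->
    (\int[mu]_(x in `[0%R, +oo[) (f x)%:E =
     \int[mu]_(x in `[0%R, s]) (f x)%:E + \int[mu]_(x in `[s, +oo[) (f x)%:E)%E.
  move=> mf f0; have mEf D : measurable_fun D (EFin \o f).
    exact/measurable_funTS/measurable_EFinP.
  rewrite -[X in (_ + X)%E]integral_itv_obnd_cbnd; last exact: mEf.
  rewrite (@itv_bndbnd_setU _ _ _ (BRight s))//= ?bnd_simp ?ltW//.
  rewrite ge0_integral_setU//=.
  - exact: mEf.
  - by move=> x _; rewrite lee_fin.
  - apply/disj_setPS => x /=; rewrite !in_itv/= andbT => -[/andP[_ xs]].
    by rewrite ltNge xs.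
rewrite !split_at_s//.
have -> : (\int[mu]_(x in `[0%R, s]) (p x)%:E =
    \int[mu]_(x in `[0%R, s]) (q x)%:E + (F s)%:E)%E.
  rewrite -I1 -ge0_integralD//=; last 4 first.
  - by move=> x _; rewrite lee_fin.
  - exact/measurable_funTS/measurable_EFinP.
  - by move=> x /=; rewrite in_itv/= => /qp; rewrite lee_fin subr_ge0.
  - apply/measurable_funTS/measurable_EFinP; exact: measurable_funB.
  by apply: eq_integral => x _; rewrite -EFinD addrC subrK.
have -> : (\int[mu]_(x in `[s, +oo[) (q x)%:E =
    \int[mu]_(x in `[s, +oo[) (p x)%:E + (F s)%:E)%E.
  rewrite -I2 -ge0_integralD//=; last 4 first.
  - by move=> x _; rewrite lee_fin.
  - exact/measurable_funTS/measurable_EFinP.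
  - by move=> x /=; rewrite in_itv/= andbT => /pq; rewrite lee_fin subr_ge0.
  - apply/measurable_funTS/measurable_EFinP; exact: measurable_funB.
  by apply: eq_integral => x _; rewrite -EFinD addrC subrK.
by rewrite -addeA [((F s)%:E + _)%E]addeC.
Qed.

Local Notation phi := (@normal_pdf R 0 1).
Let phi_continuous : continuous phi. Proof. exact: continuous_normal_pdf. Qed.
Let phi_ge0 (x : R) : 0 <= phi x. Proof. exact: normal_pdf_ge0. Qed.
Let phiE (x : R) : phi x = normal_peak 1 * expR (- (x ^+ 2 / 2)).
Proof. by rewrite normal_pdfE// /normal_fun subr0 expr1n mulNr. Qed.
Let phiN (x : R) : phi (- x) = phi x. Proof. by rewrite !phiE sqrrN. Qed.

Let is_derive_phi (x : R) : is_derive x 1 phi (- x * phi x).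
Proof.
have -> : phi = (fun x => normal_peak 1 * expR (- (x ^+ 2 / 2))).
  by apply/funext => y; rewrite phiE.
apply: is_derive_eq.
by rewrite /GRing.scale/=; field.
Qed.

(** From exp y >= y^2 / 2 at y = x^2 / 2 follows exp (- x^2 / 2) <= 8 / x^4, so that for x >= 1 the
    function is at most a constant times 1 / x. *)
Let cvg_Xn_phi (n : nat) : (n <= 3)%N -> x ^+ n * phi x @[x --> +oo] --> (0 : R).
Proof.
move=> n3.
apply: (@squeeze_cvgr _ _ _ _ (fun=> 0) (fun x => 8 * normal_peak 1 * x^-1)).
- near=> x.
  have x1 : 1 <= x by near: x; exact: nbhs_pinfty_ge.
  have x0 : 0 < x by exact: lt_le_trans x1.
  have x4 : 0 < x ^+ 4 by rewrite exprn_gt0.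
  apply/andP; split; first by rewrite mulr_ge0// exprn_ge0// ltW.
  have E : expR (- (x ^+ 2 / 2)) <= 8 / x ^+ 4.
    rewrite expRN -[leRHS]invrK lef_pV2 ?posrE ?expR_gt0 ?invr_gt0 ?divr_gt0// invf_div.
    have /(expR_ge1Dxn 1) : 0 <= x ^+ 2 / 2 by rewrite divr_ge0 ?sqr_ge0.
    apply: le_trans; rewrite ler_wpDl// (_ : 2`!%:R = 2)//.
    by rewrite [leLHS](_ : _ = (x ^+ 2 / 2) ^+ 2 / 2)//; field.
  rewrite phiE; apply: (le_trans (ler_wpM2l _ (ler_wpM2l _ E))) => //.
  + by rewrite exprn_ge0// ltW.
  + exact: normal_peak_ge0.
  have -> : x ^+ n * (normal_peak 1 * (8 / x ^+ 4)) =
      8 * normal_peak 1 * (x ^+ n / x ^+ 4) by ring.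
  rewrite ler_wpM2l ?mulr_ge0 ?normal_peak_ge0//.
  rewrite ler_pdivrMr// exprS mulKf ?gt_eqF//.
  exact: ler_weXn2l.
- exact: cvg_cst.
- rewrite -[X in _ --> X](mulr0 (8 * normal_peak 1)); apply: cvgMr.
  by apply/gtr0_cvgV0 => //; exact: nbhs_pinfty_gt.
Unshelve. all: by end_near. Qed.

Let integralT_even (f : R -> R) : (forall x, 0 <= f x) -> continuous f ->
  (forall x, f (- x) = f x) ->
  (\int[mu]_x (f x)%:E = 2%:E * \int[mu]_(x in `[0%R, +oo[) (f x)%:E)%E.
Proof.
by move=> f0 cf fN; rewrite set_itvcy ge0_symfun_integralT// => x /=; rewrite fN.
Qed.

Let continuous_Xn_phi (n : nat) : continuous (fun x : R => x ^+ n * phi x).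
Proof. by move=> x; apply: cvgM; [exact: exprn_continuous|exact: phi_continuous]. Qed.

(** The derivative of [x * phi x] is [phi x - x ^+ 2 * phi x], which changes sign at 1; hence the
    second moment equals the total mass. *)
Lemma integral_normal_moment2 : (\int[mu]_x (x ^+ 2 * phi x)%:E = 1)%E.
Proof.
rewrite -(integral_normal_pdf 0 1) !integralT_even//; last 2 first.
- by move=> x; rewrite mulr_ge0 ?sqr_ge0.
- by move=> x; rewrite sqrrN phiN.
congr (_ * _)%E; apply/esym.
apply: (@ge0_integral_derive_eq _ _ (fun x => x ^+ 1 * phi x) 1) => //.
- by move=> x; rewrite mulr_ge0 ?sqr_ge0.
- by move=> x; have ? := is_derive_phi x; apply: is_derive_eq; rewrite /GRing.scale/=; ring.
- by move=> x /andP[x0 x1]; rewrite ler_piMl// exprn_ile1.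
- by move=> x x1; rewrite ler_peMl// exprn_ege1.
- by rewrite expr1 mul0r.
- exact: cvg_Xn_phi.
Qed.

(** The derivative of [x ^+ 3 * phi x] is [3 * (x ^+ 2 * phi x) - x ^+ 4 * phi x], which changes
    sign at the square root of 3; hence the fourth moment is three times the second. *)
Lemma integral_normal_moment4 : (\int[mu]_x (x ^+ 4 * phi x)%:E = 3%:E)%E.
Proof.
have x2 (x : R) : 0 <= 3 * (x ^+ 2 * phi x) by rewrite mulr_ge0// mulr_ge0// sqr_ge0.
have x4E (x : R) : x ^+ 4 = x ^+ 2 * x ^+ 2 by rewrite -exprD.
have x4 (x : R) : 0 <= x ^+ 4 by rewrite exprn_even_ge0.
transitivity (\int[mu]_x (3 * (x ^+ 2 * phi x))%:E)%E; last first.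
  under eq_integral do rewrite EFinM.
  rewrite ge0_integralZl//; first by rewrite integral_normal_moment2 mule1.
  + by apply/measurable_EFinP; apply: continuous_measurable_fun.
  + by move=> x _; rewrite lee_fin mulr_ge0 ?sqr_ge0.
have c2 : continuous (fun x : R => 3 * (x ^+ 2 * phi x)).
  by move=> x; apply: cvgMr; exact: continuous_Xn_phi.
rewrite !integralT_even//; last 3 first.
- by move=> x; rewrite sqrrN phiN.
- by move=> x; rewrite mulr_ge0.
- by move=> x; rewrite phiN exprNn -signr_odd/= mul1r.
congr (_ * _)%E; apply/esym.
have s3 : (Num.sqrt 3 : R) ^+ 2 = 3 by rewrite sqr_sqrtr.
apply: (@ge0_integral_derive_eq _ _ (fun x => x ^+ 3 * phi x) (Num.sqrt 3)) => //.
- by move=> x; rewrite mulr_ge0.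
- by move=> x; have ? := is_derive_phi x; apply: is_derive_eq; rewrite /GRing.scale/=; ring.
- move=> x /andP[x0 x1]; rewrite mulrA ler_wpM2r// x4E.
  by rewrite ler_wpM2r ?sqr_ge0// -s3 ler_pXn2r// nnegrE sqrtr_ge0.
- move=> x x1; rewrite mulrA ler_wpM2r// x4E.
  rewrite ler_wpM2r ?sqr_ge0// -[leLHS]s3 ler_pXn2r// nnegrE ?sqrtr_ge0//.
  by rewrite (le_trans _ x1)// sqrtr_ge0.
- by rewrite expr0n mul0r.
- exact: cvg_Xn_phi.
Qed.

(** Folding the line at 0 writes each integral as the sum of those of [h x] and [h (- x)] over the
    half-line, and the reflection only exchanges the two. *)
Lemma ge0_integral_oppr (h : R -> R) : continuous h -> (forall x, 0 <= h x) ->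
  (\int[mu]_x (h (- x))%:E = \int[mu]_x (h x)%:E)%E.
Proof.
have split0 (f : R -> R) : continuous f -> (forall x, 0 <= f x) ->
    (\int[mu]_x (f x)%:E = \int[mu]_(x in `[0%R, +oo[) (f (- x))%:E +
      \int[mu]_(x in `[0%R, +oo[) (f x)%:E)%E.
  move=> cf f0; have mf : measurable_fun setT f by exact: continuous_measurable_fun.
  have mEf D : measurable_fun D (EFin \o f).
    exact/measurable_funTS/measurable_EFinP.
  rewrite -(ge0_integration_by_substitutionNy); last 2 first.
  - exact: continuous_subspaceT.
  - by move=> x _.
  rewrite -[X in (_ + X)%E]integral_itv_obnd_cbnd; last exact: mEf.
  rewrite -(itv_setU_setT false (0 : R)) ge0_integral_setU//= ?oppr0//.
  - exact: mEf.
  - by move=> x _; rewrite lee_fin.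
  - apply/disj_setPS => x /=; rewrite !in_itv/= andbT => -[xs].
    by rewrite ltNge xs.
move=> ch h0; rewrite split0 => [|x|//]; last first.
  by apply: (cvg_comp _ _ (@oppr_continuous _ _ x)); exact: ch.
rewrite [RHS]split0// addeC; congr (_ + _)%E.
by apply: eq_integral => x _; rewrite opprK.
Qed.

End gaussian_moments.

(** * Moments of the entries *)

Section rv_moments.
Local Open Scope ereal_scope.
Context {dT : measure_display} {T : measurableType dT} {R : realType}
  {P : probability T R} (X : {RV P >-> R}).
Notation mu := (@lebesgue_measure R).
Implicit Types f h : R -> R.

(** The law of [X] is known only through its values on sets; the transfer lemma, used with the
    identity map and the density [normal_pdf 0 1], carries this over to integrals. *)
Lemma std_gaussian_ge0_integral f : std_gaussian_rv P X ->
  measurable_fun setT f -> (forall x, (0 <= f x)%R) ->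
  \int[P]_t (f (X t))%:E = \int[mu]_x (f x * normal_pdf 0 1 x)%:E.
Proof.
move=> gX mf f0.
rewrite (ge0_integral_image_density mu (distribution P X) id (normal_pdf 0 1) 1)//.
- rewrite mul1e ge0_integral_distribution//=; exact/measurable_EFinP.
- exact: measurable_normal_pdf.
- exact: normal_pdf_ge0.
- by move=> B mB; rewrite mul1e [RHS](gX B mB).
Qed.

(** The events [X = 1] and [X = -1] are disjoint and exhaust the mass, so [f] of [X] agrees almost
    everywhere with a combination of their two indicators. *)
Lemma rademacher_ge0_integral f : rademacher_rv P X ->
  measurable_fun setT f -> (forall x, (0 <= f x)%R) ->
  \int[P]_t (f (X t))%:E = ((f 1 + f (-1)) / 2)%:E.
Proof.
have N1 : (1 <> -1 :> R)%R by move=> ?; lra.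
move=> [P1 PN1] mf f0.
have mA (a : R) : measurable (X @^-1` [set a]) by exact: measurable_funPTI.
have AI : X @^-1` [set 1%R] `&` X @^-1` [set (-1)%R] = set0.
  by apply/seteqP; split => // t [/= -> /N1].
have PU : P (X @^-1` [set 1%R] `|` X @^-1` [set (-1)%R]) = 1.
  rewrite measureU// [RHS](_ : _ = (2^-1 + 2^-1)%:E)%R.
    by rewrite EFinD; congr (_ + _).
  by congr EFin; field.
have PUC : P (~` (X @^-1` [set 1%R] `|` X @^-1` [set (-1)%R])) = 0.
  by rewrite probability_setC ?PU ?subee//; exact: measurableU.
pose g t := (f 1 * \1_(X @^-1` [set 1%R]) t + f (-1) * \1_(X @^-1` [set (-1)%R]) t)%R.
have mg a : measurable_fun setT (fun t => f a * \1_(X @^-1` [set a]) t)%R.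
  by apply: measurable_funM => //; exact: measurable_indic.
have g0 a t : (0 <= f a * \1_(X @^-1` [set a]) t)%R.
  by rewrite mulr_ge0// indicE.
rewrite (@ge0_ae_eq_integral _ _ _ P _ _ (EFin \o g))//=.
- under eq_integral do rewrite EFinD.
  rewrite ge0_integralD//; last 4 first.
  + by move=> t _; rewrite lee_fin.
  + exact/measurable_EFinP.
  + by move=> t _; rewrite lee_fin.
  + exact/measurable_EFinP.
  have I a : \int[P]_t (f a * \1_(X @^-1` [set a]) t)%:E = (f a)%:E * P (X @^-1` [set a]).
    under eq_integral do rewrite EFinM.
    rewrite ge0_integralZl//; first by rewrite integral_indic// setIT.
      by apply/measurable_EFinP; exact: measurable_indic.
    by rewrite lee_fin.
  by rewrite !I P1 PN1 -!EFinM -EFinD mulrDl.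
- by apply/measurable_EFinP; exact: measurableT_comp.
- by apply/measurable_EFinP; exact: measurable_funD.
- by move=> t _; rewrite lee_fin.
- by move=> t _; rewrite lee_fin addr_ge0.
exists (~` (X @^-1` [set 1%R] `|` X @^-1` [set (-1)%R])); split.
- by apply: measurableC; exact: measurableU.
- exact: PUC.
- apply: subsetC => t /= tU _; congr EFin; rewrite /g !indicE.
  have memX a : (t \in X @^-1` [set a]) = (X t == a).
    by apply/idP/eqP => [/set_mem|?]//; exact/mem_set.
  have /eqP/negPf N1' := N1; rewrite !memX.
  case: tU => ->; rewrite ?(eq_sym _ 1%R) eqxx N1' mulr1 mulr0.
    by rewrite addr0.
  by rewrite add0r.
Qed.

(** Reflection exchanges the positive and negative parts of an odd function, so these have equal
    integrals; integrability makes the integrals finite and their difference 0. *)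
Lemma odd_integral0 f : continuous f -> (forall x, f (- x) = - f x)%R ->
  (forall h, continuous h -> (forall x, 0 <= h x)%R ->
    \int[P]_t (h (- X t))%:E = \int[P]_t (h (X t))%:E) ->
  P.-integrable setT (fun t => (f (X t))%:E) -> \int[P]_t (f (X t))%:E = 0.
Proof.
move=> cf fN symX intf.
have E : \int[P]_t (Num.max (f (X t)) 0)%:E = \int[P]_t (Num.max (- f (X t)) 0)%:E.
  rewrite -(symX (fun x => Num.max (f x) 0%R)).
  - by apply: eq_integral => t _; rewrite fN.
  - move=> x; apply: (@continuous_max _ _ _ (fun=> 0%R)) => //; [exact: cf|exact: cvg_cst].
  - by move=> x; rewrite le_max lexx orbT.
have mfX : measurable_fun setT (f \o X).
  by apply: measurableT_comp => //; exact: continuous_measurable_fun.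
rewrite integralE.
have -> : \int[P]_t (fun t => (f (X t))%:E)^\+ t = \int[P]_t (Num.max (f (X t)) 0)%:E.
  by apply: eq_integral => t _; rewrite funeposE -EFin_max.
have -> : \int[P]_t (fun t => (f (X t))%:E)^\- t = \int[P]_t (Num.max (- f (X t)) 0)%:E.
  by apply: eq_integral => t _; rewrite funenegE -EFin_max.
rewrite -E subee//.
apply: (@integrable_fin_num _ _ _ P) => //.
apply: le_integrable intf => //.
  by apply/measurable_EFinP; exact: measurable_maxr.
move=> t _ /=; rewrite lee_fin [leLHS]ger0_norm; last by rewrite le_max lexx orbT.
by rewrite ge_max ler_norm normr_ge0.
Qed.

Definition entry_law (g : bool) := if g then std_gaussian_rv P X else rademacher_rv P X.

(* Junk value 1 at even n >= 6. *)
Definition entry_moment (g : bool) (n : nat) : R :=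
  (if odd n then 0 else if n == 4%N then (if g then 3 else 1) else 1)%R.

Lemma entry_law_integral_opp (g : bool) h : entry_law g -> continuous h ->
  (forall x, 0 <= h x)%R -> \int[P]_t (h (- X t))%:E = \int[P]_t (h (X t))%:E.
Proof.
move=> gX ch h0.
have chN : continuous (fun x : R => h (- x)%R).
  by move=> x; apply: (cvg_comp _ _ (@oppr_continuous _ _ x)); exact: ch.
have mh : measurable_fun setT h by exact: continuous_measurable_fun.
have mhN : measurable_fun setT (fun x : R => h (- x)%R) by exact: continuous_measurable_fun.
case: g gX => gX.
  rewrite (std_gaussian_ge0_integral (fun x : R => h (- x)%R))//.
  rewrite (std_gaussian_ge0_integral h)//.
  rewrite -[RHS]ge0_integral_oppr.
  - apply: eq_integral => x _; rewrite !normal_pdfE// /normal_fun.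
    by rewrite !subr0 sqrrN.
  - by move=> x; apply: cvgM; [exact: ch|exact: continuous_normal_pdf].
  - by move=> x; rewrite mulr_ge0// normal_pdf_ge0.
rewrite (rademacher_ge0_integral (fun x : R => h (- x)%R))//.
by rewrite (rademacher_ge0_integral h)// opprK addrC.
Qed.

Lemma entry_law_moment4 (g : bool) : entry_law g ->
  \int[P]_t (X t ^+ 4)%:E = (entry_moment g 4)%:E.
Proof.
have x4 (x : R) : (0 <= x ^+ 4)%R by rewrite exprn_even_ge0.
have mx4 : measurable_fun setT (fun x : R => x ^+ 4)%R.
  by apply: continuous_measurable_fun; exact: exprn_continuous.
case: g => gX.
  by rewrite (std_gaussian_ge0_integral (fun x => x ^+ 4)%R)// integral_normal_moment4.
rewrite (rademacher_ge0_integral (fun x => x ^+ 4)%R)// /entry_moment/=.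
by congr EFin; field.
Qed.

(** For n <= 4 the n-th power is dominated by 1 + x^4, and the fourth moment is finite. *)
Lemma entry_law_integrable (g : bool) (n : nat) : entry_law g -> (n <= 4)%N ->
  P.-integrable setT (fun t => (X t ^+ n)%:E).
Proof.
move=> gX n4.
have int4 : P.-integrable setT (fun t => (X t ^+ 4)%:E).
  apply/integrableP; split.
    by apply/measurable_EFinP; exact: measurable_funX.
  under eq_integral do rewrite /= ger0_norm ?exprn_even_ge0//.
  by rewrite (entry_law_moment4 g)// ltry.
have int1 : P.-integrable setT (fun t => (1 + X t ^+ 4)%:E).
  under eq_fun do rewrite EFinD.
  by apply: integrableD => //; exact: finite_measure_integrable_cst.
apply: le_integrable int1 => //.
  by apply/measurable_EFinP; exact: measurable_funX.
move=> t _; rewrite /= lee_fin normrX.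
have x4 : (X t ^+ 4 = `|X t| ^+ 4)%R by rewrite -normrX ger0_norm// exprn_even_ge0.
rewrite x4 [leRHS]ger0_norm ?addr_ge0 ?exprn_ge0//.
have [x1|x1] := leP `|X t|%R 1%R.
  by rewrite (@le_trans _ _ 1%R)// ?exprn_ile1// lerDl exprn_ge0.
by rewrite (@le_trans _ _ (`|X t| ^+ 4)%R)// ?ler_weXn2l ?lerDr// ltW.
Qed.

Lemma entry_law_moment (g : bool) (n : nat) : entry_law g -> (n <= 4)%N ->
  \int[P]_t (X t ^+ n)%:E = (entry_moment g n)%:E.
Proof.
move=> gX n4; rewrite /entry_moment; case: ifPn => [on|en].
  apply: (odd_integral0 (fun x => x ^+ n)%R); last exact: (entry_law_integrable g).
  - exact: exprn_continuous.
  - by move=> x; rewrite exprNn -signr_odd on mulN1r.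
  - by move=> h; exact: (entry_law_integral_opp g).
have [n_4|] := eqVneq n 4%N.
  by rewrite n_4 (entry_law_moment4 g)// /entry_moment.
case: n n4 en => [_ _ _|[//|[_ _ _|[//|[//|//]]]]].
  under eq_integral do rewrite expr0.
  by rewrite integral_cst//= probability_setT mule1.
have mx2 : measurable_fun setT (fun x : R => x ^+ 2)%R.
  by apply: continuous_measurable_fun; exact: exprn_continuous.
case: g gX => gX.
  rewrite (std_gaussian_ge0_integral (fun x => x ^+ 2)%R)//.
    exact: integral_normal_moment2.
  by move=> x; exact: sqr_ge0.
rewrite (rademacher_ge0_integral (fun x => x ^+ 2)%R)//.
  by congr EFin; field.
by move=> x; exact: sqr_ge0.
Qed.

End rv_moments.

(** * Partial traces and moment kernels *)

Section tensor_algebra.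
Local Open Scope ring_scope.
Context {R : realType} {d k : nat}.
Local Notation idx := (midx d 'I_k).
Local Notation mat := (tmat R d 'I_k).
Local Notation tglue := (@Defs.glue d k).
Implicit Types (z : idx * idx) (V S : {set 'I_k}).

Let sum_delta (J : finType) (y : J) (F : J -> R) :
  \sum_x (x == y)%:R * F x = F y.
Proof.
rewrite (bigD1 y)//= eqxx mul1r big1 ?addr0// => x /negPf ->.
by rewrite mul0r.
Qed.

Let prod_delta (J : finType) (c : J -> bool) :
  \prod_j (c j)%:R = [forall j, c j]%:R :> R.
Proof.
have [/forallP call|] := boolP [forall j, c j].
  by rewrite big1// => j _; rewrite call.
rewrite negb_forall => /existsP[j /negPf cj].
by rewrite (bigD1 j)//= cj mul0r.
Qed.

Let prodrD_sets (f h : 'I_k -> R) :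
  \prod_j (f j + h j) = \sum_(S : {set 'I_k}) \prod_j (if j \in S then f j else h j).
Proof. exact: bigA_distr. Qed.

(** * Invariance under partial transposition *)

Definition swap V z : idx * idx :=
  ([ffun j => if j \in V then z.2 j else z.1 j],
   [ffun j => if j \in V then z.1 j else z.2 j]).

Lemma swapK V : involutive (swap V).
Proof.
move=> [a b]; congr pair; apply/ffunP => j; rewrite !ffunE/=.
  by case: (j \in V).
by case: (j \in V).
Qed.

Let eval (M : mat) z := M z.1 z.2.

Lemma ptransposeE V M z : ptranspose V M z.1 z.2 = eval M (swap V z).
Proof. by []. Qed.

Lemma quad_formE M (x : 'I_k -> 'I_d -> R) :
  quad_form M (tensor_vec x) =
  \sum_z eval M z * \prod_j (x j (z.1 j) * x j (z.2 j)).
Proof.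
rewrite /quad_form pair_bigA/=; apply: eq_bigr => z _.
by rewrite /tensor_vec big_split/= mulrAC mulrC.
Qed.

Lemma card_set_ord : #|{set 'I_k}| = (2 ^ k)%N.
Proof. by rewrite -cardsT -powersetT card_powerset cardsT card_ord. Qed.

(** Reindexing by [swap V] only exchanges commuting factors [x j (z.1 j)] and [x j (z.2 j)], so all
    2^k partial transposes share one quadratic form. *)
Lemma quad_form_avg_ptranspose M (x : 'I_k -> 'I_d -> R) :
  quad_form (avg_ptranspose M) (tensor_vec x) = quad_form M (tensor_vec x).
Proof.
rewrite !quad_formE /eval /avg_ptranspose.
under eq_bigr do rewrite -mulrA mulr_suml.
rewrite -mulr_sumr exchange_big/=.
rewrite (eq_bigr (fun=> \sum_z M z.1 z.2 * \prod_j (x j (z.1 j) * x j (z.2 j)))).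
  by rewrite sumr_const card_set_ord -[X in _ * X]mulr_natl natrX mulKf// expf_neq0.
move=> V _; rewrite (reindex_inj (inv_inj (swapK V))); apply: eq_bigr => z _.
rewrite ptransposeE swapK; congr (_ * _).
by apply: eq_bigr => j _; rewrite /= !ffunE; case: ifP => // _; rewrite mulrC.
Qed.

(** Composing the partial transposes over [V] and [W] gives the one over their symmetric difference,
    so the terms of the average are merely permuted. *)
Lemma avg_ptranspose_swap V M z :
  eval (avg_ptranspose M) (swap V z) = eval (avg_ptranspose M) z.
Proof.
rewrite /eval /avg_ptranspose; congr (_ * _).
pose xor (W : {set 'I_k}) := [set j | (j \in W) (+) (j \in V)]%SET.
have xorK : involutive xor by move=> W; apply/setP => j; rewrite !finset.inE addbK.
rewrite [RHS](reindex_inj (inv_inj xorK)); apply: eq_bigr => W _.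
rewrite !ptransposeE; congr (eval _ _).
congr pair; apply/ffunP => j; rewrite !ffunE/= ?ffunE finset.inE.
  by case: (j \in W); case: (j \in V).
by case: (j \in W); case: (j \in V).
Qed.

(** * Partial traces as sums over pairs of multi-indices *)

Let kept S (a : idx) : midx d {j : 'I_k | j \notin S} := [ffun u => a (val u)].
Let traced S (a : idx) : midx d {j : 'I_k | j \in S} := [ffun u => a (val u)].

Let glue_in S a0 l j (h : j \in S) : tglue S a0 l j = l (exist _ j h).
Proof.
rewrite ffunE.
(* Generalising the boolean together with its equation lets the dependent match reduce; the two
   membership proofs then agree by irrelevance. *)
suff G (b : bool) (e : (j \in S) = b) :
    (if b as b return (j \in S) = b -> 'I_d then fun h => l (exist _ j h)
     else fun h => a0 (exist _ j (negbT h))) e = l (exist _ j h) by exact: G.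
case: b e => e; last by exfalso; rewrite h in e.
by congr (l (exist _ j _)); exact: bool_irrelevance.
Qed.

Let glue_out S a0 l j (h : j \notin S) : tglue S a0 l j = a0 (exist _ j h).
Proof.
rewrite ffunE.
suff G (b : bool) (e : (j \in S) = b) :
    (if b as b return (j \in S) = b -> 'I_d then fun h => l (exist _ j h)
     else fun h => a0 (exist _ j (negbT h))) e = a0 (exist _ j h) by exact: G.
case: b e => e; first by exfalso; rewrite e in h.
by congr (a0 (exist _ j _)); exact: bool_irrelevance.
Qed.

Let traced_glue S a0 l : traced S (tglue S a0 l) = l.
Proof. by apply/ffunP => -[j h]; rewrite ffunE/= glue_in. Qed.

Let kept_glue S a0 l : kept S (tglue S a0 l) = a0.
Proof. by apply/ffunP => -[j h]; rewrite ffunE/= glue_out. Qed.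

Let glue_kept_traced S a : tglue S (kept S a) (traced S a) = a.
Proof.
apply/ffunP => j; have [h|h] := boolP (j \in S).
  by rewrite glue_in ffunE.
by rewrite glue_out ffunE.
Qed.

Let sum_glue S (F : idx -> R) : \sum_a F a = \sum_a0 \sum_l F (tglue S a0 l).
Proof.
rewrite pair_bigA/= (reindex (fun p => tglue S p.1 p.2))//=.
exists (fun a => (kept S a, traced S a)) => [[a0 l] _|a _] /=.
  by rewrite kept_glue traced_glue.
exact: glue_kept_traced.
Qed.

(** The coefficient with which the entry of a matrix at [z] enters the entry [(a0, b0)] of its
    partial trace over [S]. *)
Let chi S a0 b0 z : R :=
  (kept S z.1 == a0)%:R * ((kept S z.2 == b0)%:R * (traced S z.1 == traced S z.2)%:R).

Let sum_chi S (M : mat) a0 b0 : \sum_z eval M z * chi S a0 b0 z = ptrace S M a0 b0.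
Proof.
rewrite -(pair_bigA _ (fun a b => eval M (a, b) * chi S a0 b0 (a, b)))/= (sum_glue S).
rewrite (eq_bigr (fun a1 => (a1 == a0)%:R * ptrace S M a1 b0)) ?sum_delta//.
move=> a1 _; rewrite /ptrace mulr_sumr; apply: eq_bigr => l _.
rewrite (sum_glue S).
rewrite (eq_bigr (fun b1 => (b1 == b0)%:R *
   ((a1 == a0)%:R * M (tglue S a1 l) (tglue S b1 l)))) ?sum_delta//.
move=> b1 _.
rewrite (eq_bigr (fun l1 => (l1 == l)%:R * ((b1 == b0)%:R *
  ((a1 == a0)%:R * M (tglue S a1 l) (tglue S b1 l1))))) ?sum_delta//.
move=> l1 _; rewrite /chi /eval/= !kept_glue !traced_glue (eq_sym l1 l).
by rewrite mulrC !mulrA; congr (_ * _); rewrite mulrC !mulrA mulrAC.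
Qed.

Let kept_eq S (a b : idx) :
  (kept S a == kept S b) = [forall j, (j \in S) || (a j == b j)].
Proof.
apply/eqP/forallP => [/ffunP ab j|ab]; last first.
  apply/ffunP => -[j h]; rewrite !ffunE/=.
  by have := ab j; rewrite (negPf h) => /eqP.
have [//|h] := boolP (j \in S).
by have := ab (exist _ j h); rewrite !ffunE/= => ->.
Qed.

Let traced_eq S (a b : idx) :
  (traced S a == traced S b) = [forall j, (j \notin S) || (a j == b j)].
Proof.
apply/eqP/forallP => [/ffunP ab j|ab]; last first.
  apply/ffunP => -[j h]; rewrite !ffunE/=.
  by have := ab j; rewrite h => /eqP.
have [h|//] := boolP (j \in S).
by have := ab (exist _ j h); rewrite !ffunE/= => ->.
Qed.

Let sum_chi2 S z z' : \sum_a0 \sum_b0 chi S a0 b0 z * chi S a0 b0 z' =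
  \prod_j (if j \in S then (z.1 j == z.2 j)%:R * (z'.1 j == z'.2 j)%:R
           else (z.1 j == z'.1 j)%:R * (z.2 j == z'.2 j)%:R).
Proof.
pose t : R := (traced S z.1 == traced S z.2)%:R.
transitivity (t * chi S (kept S z.1) (kept S z.2) z').
  rewrite (eq_bigr (fun a0 => (a0 == kept S z.1)%:R * (t * chi S a0 (kept S z.2) z'))).
    by rewrite sum_delta.
  move=> a0 _; rewrite (eq_bigr (fun b0 => (b0 == kept S z.2)%:R *
    ((a0 == kept S z.1)%:R * (t * chi S a0 b0 z')))) ?sum_delta// => b0 _.
  rewrite [chi S a0 b0 z]/chi -/t (eq_sym a0) (eq_sym b0).
  by rewrite -mulrA -mulrA mulrCA.
rewrite /chi /t -!natrM !mulnb !kept_eq !traced_eq.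
transitivity (\prod_j ((if j \in S then (z.1 j == z.2 j) && (z'.1 j == z'.2 j)
           else (z.1 j == z'.1 j) && (z.2 j == z'.2 j))%:R : R)); last first.
  by apply: eq_bigr => j _; case: ifP; rewrite -natrM mulnb.
rewrite prod_delta; congr (_%:R); congr nat_of_bool.
apply/and4P/forallP => [[/forallP h1 /forallP h2 /forallP h3 /forallP h4] j|h].
  have := h1 j; have := h2 j; have := h3 j; have := h4 j.
  rewrite (eq_sym (z'.1 j) (z.1 j)) (eq_sym (z'.2 j) (z.2 j)).
  by case: (j \in S) => /= [-> _ _ ->|_ -> -> _].
by split; apply/forallP => j; have := h j; case: (j \in S) => //= /andP[h1 h2];
  rewrite // eq_sym.
Qed.

(** Squaring an entry of the partial trace doubles the sum over [z]; summing over the entries then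
    forces the kept parts of [z] and [z'] to agree, and the constraints factor over the sites. *)
Lemma frob2_ptrace S (M : mat) : frob2 (ptrace S M) =
  \sum_z \sum_z' eval M z * eval M z' *
  \prod_j (if j \in S then (z.1 j == z.2 j)%:R * (z'.1 j == z'.2 j)%:R
           else (z.1 j == z'.1 j)%:R * (z.2 j == z'.2 j)%:R).
Proof.
rewrite /frob2.
under eq_bigr do under eq_bigr do rewrite -sum_chi expr2 mulr_suml.
transitivity (\sum_z \sum_z' eval M z * eval M z' *
   \sum_a0 \sum_b0 chi S a0 b0 z * chi S a0 b0 z'); last first.
  by apply: eq_bigr => z _; apply: eq_bigr => z' _; rewrite sum_chi2.
rewrite pair_bigA/= exchange_big/=; apply: eq_bigr => z _.
under eq_bigr do rewrite mulr_sumr.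
rewrite exchange_big/=; apply: eq_bigr => z' _.
rewrite [in RHS]pair_bigA/= mulr_sumr; apply: eq_bigr => p _.
by rewrite mulrACA.
Qed.

(** When every site is traced, the constraints on [z] and [z'] separate and leave the square of the
    full trace, which is the squared mean of the quadratic form. *)
Lemma frob2_ptraceT (M : mat) : frob2 (ptrace finset.setT M) =
  (\sum_z eval M z * \prod_j (z.1 j == z.2 j)%:R) ^+ 2.
Proof.
rewrite frob2_ptrace expr2 mulr_suml; apply: eq_bigr => z _.
rewrite mulr_sumr; apply: eq_bigr => z' _; rewrite [RHS]mulrACA; congr (_ * _).
by rewrite -big_split; apply: eq_bigr => j _; rewrite finset.in_setT.
Qed.

(** Isserlis' formula for the expectation of a product of four entries of a standard Gaussian
    vector. *)
Definition pairing_kernel (p q r s : 'I_d) : R :=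
  (p == q)%:R * (r == s)%:R + ((p == r)%:R * (q == s)%:R + (p == s)%:R * (q == r)%:R).

Definition kernel_form (K : 'I_k -> 'I_d -> 'I_d -> 'I_d -> 'I_d -> R) (M : mat) : R :=
  \sum_z \sum_z' eval M z * eval M z' *
  \prod_j K j (z.1 j) (z.2 j) (z'.1 j) (z'.2 j).

(* Averaging over the partial transposes V of the second copy of M replaces the
   pairing (p r)(q s) by the mean of (p r)(q s) and (p s)(q r). *)
Let frob2_ptrace_pairings S (M : mat) :
  (forall V z, eval M (swap V z) = eval M z) ->
  2 ^+ (k - #|S|) * frob2 (ptrace S M) =
  kernel_form (fun j p q r s => if j \in S then (p == q)%:R * (r == s)%:R
    else (p == r)%:R * (q == s)%:R + (p == s)%:R * (q == r)%:R) M.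
Proof.
(* The extra power of 2 completes the coefficient to 2^k, the number of sets [V] to be summed
   over. *)
move=> Msym; apply: (@mulfI _ (2 ^+ #|S|)); first by rewrite expf_neq0.
rewrite mulrA -exprD subnKC; last by rewrite -[leqRHS]card_ord max_card.
pose PS z z' : R := \prod_j (if j \in S then (z.1 j == z.2 j)%:R * (z'.1 j == z'.2 j)%:R
           else (z.1 j == z'.1 j)%:R * (z.2 j == z'.2 j)%:R).
transitivity (\sum_(V : {set 'I_k}) \sum_z \sum_z'
    eval M z * eval M z' * PS z (swap V z')).
  rewrite (eq_bigr (fun=> frob2 (ptrace S M))).
    by rewrite sumr_const card_set_ord -[RHS]mulr_natl natrX.
  move=> V _; rewrite frob2_ptrace; apply: eq_bigr => z _.
  rewrite (reindex_inj (inv_inj (swapK V))); apply: eq_bigr => z' _.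
  by rewrite swapK Msym.
rewrite /kernel_form exchange_big mulr_sumr; apply: eq_bigr => z _.
rewrite exchange_big mulr_sumr; apply: eq_bigr => z' _ /=.
rewrite -mulr_sumr mulrCA; congr (_ * _).
transitivity (\prod_j (if j \in S then 2 * ((z.1 j == z.2 j)%:R * (z'.1 j == z'.2 j)%:R)
    else (z.1 j == z'.1 j)%:R * (z.2 j == z'.2 j)%:R +
         (z.1 j == z'.2 j)%:R * (z.2 j == z'.1 j)%:R) : R); last first.
  rewrite -prodr_const [in RHS]big_mkcond -big_split/=; apply: eq_bigr => j _.
  by case: ifP; rewrite ?mul1r.
(* The two summands are the cases [j \in V] and [j \notin V]. At a site of [S] they are equal, which
   accounts for the factor 2 there. *)
rewrite [RHS](eq_bigr (fun j =>
   (if j \in S then (z.1 j == z.2 j)%:R * (z'.2 j == z'.1 j)%:R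
    else (z.1 j == z'.2 j)%:R * (z.2 j == z'.1 j)%:R) +
   (if j \in S then (z.1 j == z.2 j)%:R * (z'.1 j == z'.2 j)%:R
    else (z.1 j == z'.1 j)%:R * (z.2 j == z'.2 j)%:R))); last first.
  move=> j _; case: ifP => _; last by rewrite addrC.
  by rewrite (eq_sym (z'.2 j)) mulr_natl mulr2n.
rewrite prodrD_sets; apply: eq_bigr => V _; apply: eq_bigr => j _ /=.
by rewrite !ffunE; case: (j \in V).
Qed.

Lemma kernel_form_pairing (M : mat) :
  (forall V z, eval M (swap V z) = eval M z) ->
  kernel_form (fun=> pairing_kernel) M =
  \sum_(S : {set 'I_k}) 2 ^+ (k - #|S|) * frob2 (ptrace S M).
Proof.
move=> Msym; under [RHS]eq_bigr do rewrite frob2_ptrace_pairings//.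
rewrite /kernel_form [RHS]exchange_big; apply: eq_bigr => z _.
rewrite [RHS]exchange_big; apply: eq_bigr => z' _ /=.
by rewrite -mulr_sumr prodrD_sets.
Qed.

(** When all four indices coincide the three pairings add up to 3, while the fourth moment of a
    Rademacher entry is 1; hence the correction by 2. *)
Definition entry_kernel (g : bool) (p q r s : 'I_d) : R :=
  pairing_kernel p q r s -
  (if g then 0 else 2 * ((p == q)%:R * ((p == r)%:R * (p == s)%:R))).

(* Both entry kernels are nonnegative combinations of the same rank one forms, so
   comparing their tensor products amounts to comparing the weights. *)
Let weight (g : bool) (t : option ('I_d * 'I_d)) : R :=
  if t is Some (i, l) then (if g || (i != l) then 2^-1 else 0) else 1.

Let form (t : option ('I_d * 'I_d)) (p q : 'I_d) : R :=
  if t is Some (i, l) then (p == i)%:R * (q == l)%:R + (p == l)%:R * (q == i)%:R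
  else (p == q)%:R.

(** [None] yields the pairing (p q)(r s). An off-diagonal pair occurs in both orders with weight
    1/2, which yields the other two pairings. A diagonal pair has form values 2, so weight 1/2
    contributes 2 at p = q = r = s, exactly what the Rademacher kernel lacks. *)
Let entry_kernel_form (g : bool) (p q r s : 'I_d) : entry_kernel g p q r s =
  \sum_t weight g t * (form t p q * form t r s).
Proof.
rewrite (bigD1 None)//= mul1r (reindex_omap Some id)/=; last by case.
pose H i l : R := weight g (Some (i, l)) * form (Some (i, l)) r s.
have -> : \sum_(t : 'I_d * 'I_d | Some t == Some t) weight g (Some t) *
    (form (Some t) p q * form (Some t) r s) = H p q + H q p.
  under eq_bigl do rewrite eqxx.
  transitivity (\sum_i \sum_l ((i == p)%:R * ((l == q)%:R * H i l) +
                              (i == q)%:R * ((l == p)%:R * H i l))).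
    rewrite pair_bigA/=; apply: eq_bigr => -[i l] _.
    rewrite /H /form/=.
    by rewrite (eq_sym p i) (eq_sym p l) (eq_sym q i) (eq_sym q l); ring.
  under eq_bigr do rewrite big_split/= -!mulr_sumr !sum_delta.
  by rewrite big_split/= !sum_delta.
rewrite {}/H /weight /form /entry_kernel /pairing_kernel (eq_sym q p).
rewrite (eq_sym r p) (eq_sym r q) (eq_sym s p) (eq_sym s q).
have [->|pq] := eqVneq p q; rewrite /= ?mul1r ?mul0r ?orbF ?orbT; last first.
  by case: g; field.
by case: g => /=; field.
Qed.

Lemma kernel_form_entry_le (g : 'I_k -> bool) (M : mat) :
  kernel_form (fun j => entry_kernel (g j)) M <=
  kernel_form (fun=> entry_kernel true) M.
Proof.
(* Choosing one rank one term [t j] at every site turns the kernel form into a weighted sum of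
   squares in which only the weights depend on [h]. *)
have E (h : 'I_k -> bool) : kernel_form (fun j => entry_kernel (h j)) M =
    \sum_(t : {ffun 'I_k -> option ('I_d * 'I_d)}) (\prod_j weight (h j) (t j)) *
      (\sum_z eval M z * \prod_j form (t j) (z.1 j) (z.2 j)) ^+ 2.
  transitivity (\sum_z \sum_z' \sum_(t : {ffun 'I_k -> option ('I_d * 'I_d)})
     (\prod_j weight (h j) (t j)) *
     ((eval M z * \prod_j form (t j) (z.1 j) (z.2 j)) *
      (eval M z' * \prod_j form (t j) (z'.1 j) (z'.2 j)))).
    apply: eq_bigr => z _; apply: eq_bigr => z' _.
    under eq_bigr do rewrite entry_kernel_form.
    rewrite bigA_distr_bigA mulr_sumr; apply: eq_bigr => t _.
    by rewrite !big_split/=; ring.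
  under eq_bigr do rewrite exchange_big/=.
  rewrite exchange_big/=; apply: eq_bigr => t _.
  rewrite expr2 mulr_suml mulr_sumr; apply: eq_bigr => z _.
  by rewrite mulr_sumr mulr_sumr.
rewrite !E; apply: ler_sum => t _; apply: ler_wpM2r; first exact: sqr_ge0.
apply: ler_prod => j _; rewrite /weight; case: (t j) => [[i l]|]; last by rewrite ler01 lexx.
by case: ifP; rewrite ?lexx/= ?invr_ge0 ?ler0n.
Qed.

End tensor_algebra.

(** * Products of entry moments as kernels *)

Section entry_products.
Local Open Scope ring_scope.
Context {R : realType} {d : nat}.
Implicit Types p q r s l : 'I_d.

(** Writes a single entry as a monomial in all coordinates, so that products of entries become
    products of powers of distinct, independent variables. *)
Lemma prod_expr_delta (x : 'I_d -> R) p : \prod_l x l ^+ (p == l) = x p.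
Proof.
rewrite (bigD1 p)//= eqxx expr1 big1 ?mulr1// => l lp.
by rewrite eq_sym (negPf lp).
Qed.

Let prod_entry_moment_odd (g : bool) (c : 'I_d -> nat) l : odd (c l) ->
  \prod_l entry_moment g (c l) = 0 :> R.
Proof. by move=> o; rewrite (bigD1 l)//= /entry_moment o mul0r. Qed.

Let prod_entry_moment_even (g : bool) (c : 'I_d -> nat) :
  (forall l, (c l == 0%N) || (c l == 2%N)) -> \prod_l entry_moment g (c l) = 1 :> R.
Proof. by move=> h; rewrite big1// => l _; case/orP: (h l) => /eqP ->. Qed.

Lemma prod_entry_moment2 (g : bool) p q :
  \prod_l entry_moment g ((p == l) + (q == l))%N = (p == q)%:R :> R.
Proof.
have [->|pq] := eqVneq p q.
  by rewrite prod_entry_moment_even// => l; case: (q == l).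
by rewrite (prod_entry_moment_odd _ _ p)// eqxx eq_sym (negPf pq).
Qed.

(** The exponent counts the occurrences of [l] among the four indices. An odd count annihilates the
    product; otherwise the indices form two distinct pairs, with value 1, or all coincide, the only
    case that depends on [g]. *)
Lemma prod_entry_moment4 (g : bool) p q r s :
  \prod_l entry_moment g ((p == l) + (q == l) + (r == l) + (s == l))%N =
  entry_kernel g p q r s :> R.
Proof.
rewrite /entry_kernel /pairing_kernel.
have [<-|pq] := eqVneq p q; rewrite /= ?mul0r.
  have [<-|rs] := eqVneq r s; rewrite /=.
    have [<-|pr] := eqVneq p r; rewrite /=.
      rewrite (bigD1 p)//= eqxx big1 => [|l lp]; last first.
        by rewrite eq_sym (negPf lp).
      by rewrite /entry_moment/=; case: g; ring.
    rewrite prod_entry_moment_even => [|l]; first by case: g => /=; ring.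
    have [<-|_] := eqVneq p l; first by rewrite (eq_sym r p) (negPf pr).
    by case: (r == l).
  case: (eqVneq p r) rs => [<-|pr] rs; rewrite /=.
    rewrite (negPf rs) (prod_entry_moment_odd _ _ s); first by case: g => /=; ring.
    by rewrite eqxx (negPf rs).
  rewrite (prod_entry_moment_odd _ _ r); first by case: g => /=; ring.
  by rewrite eqxx (negPf pr) (eq_sym s r) (negPf rs).
rewrite mulr0 if_same subr0 add0r.
have [<-|pr] := eqVneq p r; rewrite /= ?mul1r ?mul0r.
  rewrite (eq_sym q p) (negPf pq) mulr0 addr0.
  have [<-|qs] := eqVneq q s.
    rewrite prod_entry_moment_even// => l.
    have [<-|_] := eqVneq p l; first by rewrite (eq_sym q p) (negPf pq).
    by case: (q == l).
  rewrite (prod_entry_moment_odd _ _ q)//.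
  by rewrite eqxx (negPf pq) (eq_sym s q) (negPf qs).
have [<-|ps] := eqVneq p s; rewrite /= ?mul1r ?mul0r add0r.
  have [<-|qr] := eqVneq q r.
    rewrite prod_entry_moment_even// => l.
    have [<-|_] := eqVneq p l; first by rewrite (eq_sym q p) (negPf pq).
    by case: (q == l).
  rewrite (prod_entry_moment_odd _ _ q)//.
  by rewrite eqxx (negPf pq) (eq_sym r q) (negPf qr).
rewrite (prod_entry_moment_odd _ _ p)//.
by rewrite eqxx (eq_sym q) (negPf pq) (eq_sym r) (negPf pr) (eq_sym s) (negPf ps).
Qed.

End entry_products.

(** * Mean and second moment of the quadratic form *)

Section monomials.
Local Open Scope ereal_scope.
Context {dT : measure_display} {T : measurableType dT} {R : realType}
  {P : probability T R} {d k : nat} (X : 'I_k -> 'I_d -> {RV P >-> R})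
  (gauss : 'I_k -> bool).
Hypothesis Xind :
  mutually_independent P (fun ij : 'I_k * 'I_d => (X ij.1 ij.2 : T -> R)).
Hypothesis Xlaw : forall i j, entry_law (X i j) (gauss i).

Let integral_monomial (n : 'I_k -> 'I_d -> nat) : (forall i j, (n i j <= 4)%N) ->
  P.-integrable setT (fun t => (\prod_i \prod_j X i j t ^+ n i j)%:E) /\
  \int[P]_t (\prod_i \prod_j X i j t ^+ n i j)%:E =
  (\prod_i \prod_j entry_moment (gauss i) (n i j))%:E.
Proof.
move=> n4.
have := indep_integral_prod (fun ij : 'I_k * 'I_d => X ij.1 ij.2) Xind
  (fun ij x => x ^+ n ij.1 ij.2)%R
  (fun ij => entry_moment (gauss ij.1) (n ij.1 ij.2)).
case.
- by move=> ij; exact: measurable_funX.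
- by move=> ij; exact: (entry_law_integrable _ (gauss ij.1)).
- by move=> ij; exact: entry_law_moment.
move=> iX eX; rewrite [in RHS]pair_bigA -eX; split.
  by under eq_fun do rewrite pair_bigA.
by apply: eq_integral => t _; rewrite pair_bigA.
Qed.

Lemma integral_monomial2 (a b : 'I_k -> 'I_d) :
  let m t := (\prod_i (X i (a i) t * X i (b i) t))%R in
  P.-integrable setT (EFin \o m) /\
  \int[P]_t (m t)%:E = (\prod_i (a i == b i)%:R)%:E.
Proof.
move=> m; pose n i j := ((a i == j) + (b i == j))%N.
have n4 i j : (n i j <= 4)%N by rewrite /n; case: eqP; case: eqP.
have mE t : m t = (\prod_i \prod_j X i j t ^+ n i j)%R.
  apply: eq_bigr => i _; under eq_bigr do rewrite exprD.
  by rewrite big_split/= !(prod_expr_delta (fun j => X i j t)).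
have [iX eX] := integral_monomial n n4; split.
  by apply: eq_integrable iX => // t _; rewrite /= mE.
under eq_integral do rewrite mE; rewrite eX; congr EFin.
by apply: eq_bigr => i _; rewrite prod_entry_moment2.
Qed.

Lemma integral_monomial4 (a b a' b' : 'I_k -> 'I_d) :
  let m t := (\prod_i (X i (a i) t * X i (b i) t * X i (a' i) t * X i (b' i) t))%R in
  P.-integrable setT (EFin \o m) /\
  \int[P]_t (m t)%:E =
  (\prod_i entry_kernel (gauss i) (a i) (b i) (a' i) (b' i))%:E.
Proof.
move=> m; pose n i j := ((a i == j) + (b i == j) + (a' i == j) + (b' i == j))%N.
have n4 i j : (n i j <= 4)%N by rewrite /n; do 4 case: eqP.
have mE t : m t = (\prod_i \prod_j X i j t ^+ n i j)%R.
  apply: eq_bigr => i _; under eq_bigr do rewrite !exprD.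
  by rewrite !big_split/= !(prod_expr_delta (fun j => X i j t)).
have [iX eX] := integral_monomial n n4; split.
  by apply: eq_integrable iX => // t _; rewrite /= mE.
under eq_integral do rewrite mE; rewrite eX; congr EFin.
by apply: eq_bigr => i _; rewrite prod_entry_moment4.
Qed.

(** [Y] and [Y * Y] are finite combinations of integrable monomials with two, respectively four,
    entries per site; integrating term by term gives both moments. *)
Lemma variance_quad_form (M : tmat R d 'I_k) :
  let Y t := quad_form M (tensor_vec (fun i j => X i j t)) in
  'V_P[Y] = (kernel_form (fun i => entry_kernel (gauss i)) M -
    (\sum_z M z.1 z.2 * \prod_i (z.1 i == z.2 i)%:R) ^+ 2)%:E.
Proof.
move=> Y.
pose m2 (z : midx d 'I_k * midx d 'I_k) t :=
  (\prod_i (X i (z.1 i) t * X i (z.2 i) t))%R.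
pose m4 (z z' : midx d 'I_k * midx d 'I_k) t :=
  (\prod_i (X i (z.1 i) t * X i (z.2 i) t * X i (z'.1 i) t * X i (z'.2 i) t))%R.
have YE t : (Y t)%:E = \sum_z (M z.1 z.2)%:E * (m2 z t)%:E.
  by rewrite /Y quad_formE -sumEFin; apply: eq_bigr => z _; rewrite EFinM.
have YYE t : ((Y * Y)%R t)%:E =
    \sum_(zz : _ * _) (M zz.1.1 zz.1.2 * M zz.2.1 zz.2.2)%:E * (m4 zz.1 zz.2 t)%:E.
  transitivity (Y t * Y t)%:E; first by [].
  rewrite /Y quad_formE mulr_suml.
  under eq_bigr do rewrite mulr_sumr.
  rewrite pair_bigA -sumEFin; apply: eq_bigr => -[z z'] _ /=.
  rewrite -EFinM mulrACA; congr (_ * _)%:E.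
  by rewrite -big_split; apply: eq_bigr => i _ /=; rewrite mulrA.
have i2 z : P.-integrable setT (fun t => (M z.1 z.2)%:E * (m2 z t)%:E).
  by apply: integrableZl => //; exact: (integral_monomial2 z.1 z.2).1.
have i4 (zz : _ * _) : P.-integrable setT
    (fun t => (M zz.1.1 zz.1.2 * M zz.2.1 zz.2.2)%:E * (m4 zz.1 zz.2 t)%:E).
  by apply: integrableZl => //; exact: (integral_monomial4 zz.1.1 zz.1.2 zz.2.1 zz.2.2).1.
have LY : Y \in Lfun P 1.
  apply/Lfun1_integrable.
  rewrite (_ : EFin \o Y = fun t => \sum_z (M z.1 z.2)%:E * (m2 z t)%:E).
    by apply: integrable_sum.
  by apply/funext => t; exact: YE.
have LYY : (Y * Y)%R \in Lfun P 1.
  apply/Lfun1_integrable; rewrite (_ : EFin \o (Y * Y)%R = fun t =>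
    \sum_(zz : _ * _) (M zz.1.1 zz.1.2 * M zz.2.1 zz.2.2)%:E * (m4 zz.1 zz.2 t)%:E).
    by apply: integrable_sum.
  by apply/funext => t; exact: YYE.
have EY : 'E_P[Y] = (\sum_z M z.1 z.2 * \prod_i (z.1 i == z.2 i)%:R)%:E.
  rewrite unlock; under eq_integral do rewrite YE.
  rewrite integral_sum// -sumEFin; apply: eq_bigr => z _.
  rewrite integralZl//; last exact: (integral_monomial2 z.1 z.2).1.
  by rewrite (integral_monomial2 z.1 z.2).2 EFinM.
have EYY : 'E_P[(Y * Y)%R] = (kernel_form (fun i => entry_kernel (gauss i)) M)%:E.
  rewrite unlock; under eq_integral do rewrite YYE.
  rewrite integral_sum// /kernel_form pair_bigA -sumEFin; apply: eq_bigr => -[z z'] _ /=.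
  rewrite integralZl//; last exact: (integral_monomial4 z.1 z.2 z'.1 z'.2).1.
  by rewrite (integral_monomial4 z.1 z.2 z'.1 z'.2).2 [in RHS]EFinM.
by rewrite /variance covarianceE// EY EYY -EFinM -EFinB.
Qed.

End monomials.

(** * The variance bound and the Gaussian equality *)

Theorem theorem1 (R : realType) (dT : measure_display) (T : measurableType dT)
  (P : probability T R) (d k : nat) (A : tmat R d 'I_k)
  (X : 'I_k -> 'I_d -> {RV P >-> R}) (gauss : 'I_k -> bool) :
  mutually_independent P (fun ij : 'I_k * 'I_d => (X ij.1 ij.2 : T -> R)) ->
  (forall i j, if gauss i then std_gaussian_rv P (X i j)
               else rademacher_rv P (X i j)) ->
  let Y := fun w : T => quad_form A (tensor_vec (fun i j => X i j w)) in
  let rhs := \sum_(S : {set 'I_k} | S != finset.setT)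
               (2 ^+ (k - #|S|))%:R * frob2 (ptrace S (avg_ptranspose A)) in
  ('V_P[Y] <= rhs%:E)%E /\ ((forall i, gauss i) -> 'V_P[Y] = rhs%:E).
Proof.
move=> Xind Xlaw Y rhs; set B := avg_ptranspose A in rhs *.
have YE : Y = (fun t => quad_form B (tensor_vec (fun i j => X i j t))).
  by apply/funext => t; rewrite quad_form_avg_ptranspose.
have Bsym V z : B (swap V z).1 (swap V z).2 = B z.1 z.2.
  exact: avg_ptranspose_swap.
have rhsE : kernel_form (fun=> entry_kernel true) B -
    (\sum_z B z.1 z.2 * \prod_i (z.1 i == z.2 i)%:R) ^+ 2 = rhs.
  have -> : kernel_form (fun=> entry_kernel true) B = kernel_form (fun=> pairing_kernel) B.
    apply: eq_bigr => z _; apply: eq_bigr => z' _; congr (_ * _).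
    by apply: eq_bigr => j _; rewrite /entry_kernel subr0.
  (* The coefficients of [rhs] are powers computed in [nat] and then cast to [R]. *)
  have natr2X n : (2 ^+ n : nat)%:R = 2 ^+ n :> R.
    by elim: n => // n IH; rewrite !exprS natrM IH.
  (* The term of the full set has coefficient 1 and cancels the squared mean, which leaves the
     proper subsets. *)
  rewrite kernel_form_pairing// (bigD1 finset.setT)//= cardsT card_ord subnn expr0 mul1r.
  by rewrite frob2_ptraceT addrAC subrr add0r; apply: eq_bigr => S _; rewrite natr2X.
rewrite YE (variance_quad_form X gauss Xind Xlaw); split=> [|gT].
  by rewrite lee_fin -rhsE lerD2r kernel_form_entry_le.
rewrite -rhsE; congr (_ - _)%:E; congr kernel_form.
by apply/funext => i; rewrite gT.
Qed.
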